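(* Let $r\ge 0$ be a real number and let $l=\{a_i\,;\,i=1,2,3,\ldots\}$ be a sequence of real numbers. Then $l$ is $r$-statistically convergent if and only if every statistically dense subsequence of $l$ is $r$-statistically convergent.
   Context: $N=\{1,2,3,\ldots\}$. For a real number $r\ge 0$ and a sequence $(x_n)$ of real numbers, a real number $x$ is an $r$-limit of $(x_n)$, written $x=r\text{-}\lim_{n\to\infty}x_n$, if for every $\varepsilon>0$ one has $|x_n-x|<r+\varepsilon$ for all but finitely many $n$ (an $r$-limit need not be unique). For $K\subseteq N$ let $K_n=\{k\in K: k\le n\}$. The asymptotic density of $K$ is $d(K)=\lim_{n\to\infty}\frac1n|K_n|$ whenever this limit exists. A number $x$ is an asymptotic $r$-density of $K$, written $x=d_r(K)$, if $x=r\text{-}\lim_{n\to\infty}\frac1n|K_n|$ (it need not be unique). For a real sequence $l=\{a_i\}$, a real number $a$ and $\varepsilon>0$, put $L_\varepsilon(a)=\{i\in N: |a_i-a|\ge\varepsilon\}$. The sequence $l$ $r$-statistically converges to $a$ if $0=d_r(L_\varepsilon(a))$ for every $\varepsilon>0$, i.e. $0$ is an $r$-limit of $\frac1n|\{i\le n: |a_i-a|\ge\varepsilon\}|$ for every $\varepsilon>0$; then $a$ is called an $r$-statistical limit of $l$. A sequence is $r$-statistically convergent if it $r$-statistically converges to some real number. A subsequence $h$ of $l$ is statistically dense in $l$ if the set of indices $i\in N$ of the terms $a_i$ of $l$ that make up $h$ has asymptotic density $1$. A subsequence is regarded as a sequence re-indexed by $1,2,3,\ldots$ in increasing order of the original indices.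 *)

(* Defs.v *)
From HB Require Import structures.
From mathcomp Require Import all_boot all_order all_algebra finmap.
From mathcomp Require Import all_classical all_reals all_analysis.
Set Implicit Arguments.
Unset Strict Implicit.
Unset Printing Implicit Defensive.
Import Order.TTheory GRing.Theory Num.Theory numFieldNormedType.Exports.
Local Open Scope classical_set_scope.
Local Open Scope ring_scope.

(* The index set N is {1, 2, 3, ...}: a real sequence is a function [nat -> R]
   whose value at 0 is junk and is never inspected below. *)
Definition posN : set nat := [set k | (0 < k)%N].

Definition is_rlimit (R : realType) (r : R) (u : nat -> R) (x : R) : Prop :=
  forall e : R, 0 < e -> \forall n \near \oo, `|u n - x| < r + e.

Definition initial_part (K : set nat) (n : nat) : set nat :=
  K `&` posN `&` [set k | (k <= n)%N].

(* [initial_part K n] is always finite, so [fset_set] is not degenerate here.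
   The value at n = 0 is irrelevant, only the behaviour at infinity is used. *)
Definition proportion (R : realType) (K : set nat) (n : nat) : R :=
  n%:R^-1 * (#|` fset_set (initial_part K n)|)%fset%:R.

Definition has_density (R : realType) (K : set nat) (x : R) : Prop :=
  proportion R K n @[n --> \oo] --> x.

Definition is_rdensity (R : realType) (r : R) (K : set nat) (x : R) : Prop :=
  is_rlimit r (proportion R K) x.

Definition deviation_set (R : realType) (l : nat -> R) (e a : R) : set nat :=
  [set i | posN i /\ e <= `|l i - a|].

Definition rstat_converges_to (R : realType) (r : R) (l : nat -> R) (a : R) :
    Prop :=
  forall e : R, 0 < e -> is_rdensity r (deviation_set l e a) 0.

Definition rstat_convergent (R : realType) (r : R) (l : nat -> R) : Prop :=
  exists a : R, rstat_converges_to r l a.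

(* A strictly increasing map from N to N. The subsequence of [l] it selects,
   re-indexed by 1, 2, 3, ..., has i-th term [l (s i)]. *)
Definition index_selection (s : nat -> nat) : Prop :=
  (forall i, posN i -> posN (s i)) /\
  (forall i j, posN i -> posN j -> (i < j)%N -> (s i < s j)%N).

Definition statistically_dense (R : realType) (s : nat -> nat) : Prop :=
  has_density (s @` posN) (1 : R).

Definition statistically_dense_subsequence (R : realType)
    (h l : nat -> R) : Prop :=
  exists s : nat -> nat,
    [/\ index_selection s, statistically_dense R s &
        forall i, posN i -> h i = l (s i)].

(* Main.v *)
Require Import Defs.
From HB Require Import structures.
From mathcomp Require Import all_boot all_order all_algebra finmap.
From mathcomp Require Import all_classical all_reals all_analysis.
Set Implicit Arguments.
Unset Strict Implicit.
Unset Printing Implicit Defensive.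
Import Order.TTheory GRing.Theory Num.Theory numFieldNormedType.Exports.
Local Open Scope classical_set_scope.
Local Open Scope ring_scope.

(** Whether a number is an r-statistical limit depends only on how many terms up
to each rank are far from it. If [h i = l (s i)], then [s] carries the ranks up
to [n] of far terms of [h] to ranks up to [s n] of far terms of [l]
([card_initial_part_selection_le]), and exactly [n] of the ranks up to [s n] are
selected ([card_initial_part_selected]). For a dense selection the latter says
that [n / s n] tends to 1, so replacing the window [s n] by [n] in a proportion
costs only a factor arbitrarily close to 1: every r-statistical limit of [l] is
one of [h] ([is_rdensity0_selection]). Conversely, [l] is a statistically dense
subsequence of itself. *)

Lemma finite_initial_part (K : set nat) (n : nat) :
  finite_set (initial_part K n).
Proof.
apply: (@sub_finite_set _ _ `I_n.+1) (finite_II _) => k /= [_].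
by rewrite ltnS.
Qed.

Lemma index_selection_id : index_selection id.
Proof. by []. Qed.

Lemma index_selection_leq (s : nat -> nat) (i j : nat) :
  index_selection s -> posN i -> posN j -> (s i <= s j)%N = (i <= j)%N.
Proof.
move=> [_ sI] i0 j0; case: (ltngtP i j) => [ij|ji|->].
- by rewrite ltnW ?sI.
- by apply/negbTE; rewrite -ltnNge sI.
- by rewrite leqnn.
Qed.

Lemma index_selection_inj (s : nat -> nat) :
  index_selection s -> {in posN &, injective s}.
Proof.
move=> sS i j /set_mem i0 /set_mem j0 sij.
have le := index_selection_leq sS.
by apply/eqP; rewrite eqn_leq -(le i j) // -(le j i) // sij leqnn.
Qed.

Lemma index_selection_ge_id (s : nat -> nat) (n : nat) :
  index_selection s -> (n <= s n)%N.
Proof.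
move=> [s_gt0 sI]; elim: n => // -[_|n IHn]; first exact: s_gt0.
by apply: leq_ltn_trans IHn _; exact: sI.
Qed.

(** [s] maps the indices of [H] up to [n] injectively to indices of [K] up to
[s n]. The intersection with [posN] leaves the junk index 0 unconstrained. *)
Lemma card_initial_part_selection_le (s : nat -> nat) (H K : set nat) (n : nat) :
  index_selection s -> posN n -> H `&` posN `<=` s @^-1` K ->
  (#|` fset_set (initial_part H n)|
     <= #|` fset_set (initial_part K (s n))|)%fset%N.
Proof.
move=> sS n0 HK; have fin := finite_initial_part.
have s_inj : {in fset_set (initial_part H n) &, injective s}.
  move=> i j; rewrite !in_fset_set // => /set_mem[[_ i0] _] /set_mem[[_ j0] _].
  by apply: (index_selection_inj sS); exact: mem_set.
have <- : (#|` s @` fset_set (initial_part H n)|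
    = #|` fset_set (initial_part H n)|)%fset by exact: card_in_imfset.
rewrite -fset_set_image //; apply: fsubset_leq_card.
rewrite -fset_set_sub //; last exact: finite_image.
move=> _ [k [[Hk k0] kn] <-]; split; first by split; [exact: HK|exact: sS.1].
by rewrite /= index_selection_leq.
Qed.

Lemma card_initial_part_selected (s : nat -> nat) (n : nat) :
  index_selection s -> posN n ->
  (#|` fset_set (initial_part (s @` posN) (s n))|)%fset = n.
Proof.
move=> sS n0; apply: card_fset_set.
(* The positive indices up to [n] are the successors of the naturals below [n]. *)
have -> : initial_part (s @` posN) (s n) = (s \o S) @` `I_n.
  apply/seteqP; split=> [_ [[[k k0 <-] _]] /=|_ [k kn <-]].
    rewrite index_selection_leq // => kn.
    by exists k.-1; rewrite /= prednK.
  split; first by split; [exists k.+1|exact: sS.1].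
  by rewrite /= index_selection_leq.
apply: inj_card_eq => i j _ _ /= sij; apply: succn_inj.
by apply: (index_selection_inj sS) sij; exact: mem_set.
Qed.

Lemma statistically_dense_id (R : realType) : statistically_dense R id.
Proof.
apply: cvg_near_cst; near=> n.
have n0 : posN n by near: n; exact: nbhs_infty_gt.
rewrite /proportion (card_initial_part_selected index_selection_id n0) mulVf //.
by rewrite pnatr_eq0 -lt0n.
Unshelve. all: by end_near. Qed.

(** [s n] has exactly [n] selected indices up to it, so the ratio is the
proportion of selected indices read along the subsequence of ranks [s n]. *)
Lemma statistically_dense_ratio_cvg1 (R : realType) (s : nat -> nat) :
  index_selection s -> statistically_dense R s ->
  (s n)%:R^-1 * n%:R @[n --> \oo] --> (1 : R).
Proof.
move=> sS sD.
have s_cvg : s n @[n --> \oo] --> \oo.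
  apply/cvgnyPge => A; near=> n.
  apply: leq_trans (index_selection_ge_id n sS).
  by near: n; exact: nbhs_infty_ge.
have := cvg_comp _ _ s_cvg sD; apply: cvg_trans; apply: near_eq_cvg; near=> n.
have n0 : posN n by near: n; exact: nbhs_infty_gt.
by rewrite /= /proportion card_initial_part_selected.
Unshelve. all: by end_near. Qed.

Lemma proportion_ge0 (R : realType) (K : set nat) (n : nat) :
  0 <= proportion R K n.
Proof. by rewrite mulr_ge0 ?invr_ge0. Qed.

(** In terms of counts, the proportion of [H] at [n] is at most that of [K] at
[s n] multiplied by [s n / n]. The first factor is eventually below
[r + e / 2], and the second tends to 1. *)
Lemma is_rdensity0_selection (R : realType) (r : R) (s : nat -> nat)
    (H K : set nat) :
  0 <= r -> index_selection s -> statistically_dense R s ->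
  H `&` posN `<=` s @^-1` K -> is_rdensity r K 0 -> is_rdensity r H 0.
Proof.
move=> r0 sS sD HK K0 e e0.
have re0 : 0 < r + e by rewrite ltr_wpDl.
(* As [n / s n] tends to 1, it eventually exceeds any constant below 1; this one
   turns the bound [r + e / 2] into [r + e]. *)
have q1 : (r + e / 2) / (r + e) < 1.
  by rewrite ltr_pdivrMr // mul1r ltrD2l ltr_pdivrMr // ltr_pMr // ltr1n.
have s_cvg := statistically_dense_ratio_cvg1 sS sD.
have e20 : 0 < e / 2 by rewrite divr_gt0.
have [M _ KM] := K0 _ e20.
near=> n.
have n0 : (0 < n)%N by near: n; exact: nbhs_infty_gt.
have sn0 : (0 < s n)%N by exact: sS.1.
rewrite subr0 ger0_norm ?proportion_ge0 //.
have Ksn : proportion R K (s n) < r + e / 2.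
  rewrite -[ltLHS]ger0_norm ?proportion_ge0 // -[X in `|X|]subr0.
  apply: KM; apply: leq_trans (index_selection_ge_id n sS).
  by near: n; exact: nbhs_infty_ge.
have ratio : (r + e / 2) / (r + e) < (s n)%:R^-1 * n%:R.
  by near: n; apply: (cvgr_gt _ s_cvg).
rewrite /proportion mulrC ltr_pdivrMr ?ltr0n //.
apply: (@le_lt_trans _ _ (proportion R K (s n) * (s n)%:R)).
  rewrite /proportion mulrC mulVKf ?pnatr_eq0 -?lt0n // ler_nat.
  exact: card_initial_part_selection_le.
apply: (@lt_trans _ _ ((r + e / 2) * (s n)%:R)).
  by rewrite ltr_pM2r // ltr0n.
rewrite [ltLHS]mulrC [ltRHS]mulrC -ltr_pdivlMl ?ltr0n //.
by rewrite mulrA -ltr_pdivrMr.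
Unshelve. all: by end_near. Qed.

Theorem theorem2p1 (R : realType) (r : R) (hr : 0 <= r) (l : nat -> R) :
  rstat_convergent r l <->
  (forall h : nat -> R, statistically_dense_subsequence h l ->
     rstat_convergent r h).
Proof.
split=> [[a la] h [s [sS sD hE]]|l_sub]; last first.
  apply: l_sub; exists id.
  by split=> //; exact: statistically_dense_id.
exists a => e e0; apply: (is_rdensity0_selection hr sS sD _ (la e e0)).
by move=> i [[_ far] i0]; split; [exact: sS.1|rewrite -hE].
Qed.
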